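(* Let $A$ and $A+\Delta A$ be real $m\times n$ matrices with $\mathrm{rank}(A)=n$ and $\|\Delta A\|_2\|A^\dagger\|_2<1$. Let $\ell_j$, $1\le j\le m$, be the leverage scores of $A$, and let $\tilde{\ell}_j$, $1\le j\le m$, be the leverage scores of $A+\Delta A$ computed (in exact arithmetic) from a QR decomposition of $A+\Delta A$. Let $$\epsilon_F=\frac{\|\Delta A\|_F}{\|A\|_F},\qquad \epsilon_j=\frac{\|e_j^T\Delta A\|_2}{\|e_j^TA\|_2}.$$ Then for every $1\le j\le m$ with $\ell_j>0$, $$\frac{|\tilde{\ell}_j-\ell_j|}{\ell_j}\le 2\left(\epsilon_j+\sqrt{2}\,\mathrm{sr}(A)^{1/2}\,\epsilon_F\right)\kappa_2(A)+\mathcal{O}(\epsilon_F^2).$$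
   Context: Leverage scores: if $A$ is a real $m\times n$ matrix with $\mathrm{rank}(A)=n$ and $Q$ is any $m\times n$ matrix whose columns form an orthonormal basis of $\mathrm{range}(A)$, the leverage scores of $A$ are $\ell_j=\|e_j^TQ\|_2^2$, $1\le j\le m$, where $e_j$ is the $j$th column of the $m\times m$ identity (this is independent of the choice of $Q$). The leverage scores computed from a thin QR decomposition $A+\Delta A=\tilde{Q}\tilde{R}$ ($\tilde{Q}$ being $m\times n$ with orthonormal columns, $\tilde{R}$ being $n\times n$ upper triangular and nonsingular) are $\tilde{\ell}_j=\|e_j^T\tilde{Q}\|_2^2$; exact arithmetic is assumed. $\|\cdot\|_2$ is the spectral norm of a matrix (Euclidean norm of a row vector), $\|\cdot\|_F$ the Frobenius norm, $A^\dagger$ the Moore-Penrose inverse, $\kappa_2(A)=\|A\|_2\|A^\dagger\|_2$, and $\mathrm{sr}(A)=\|A\|_F^2/\|A\|_2^2$ is the stable rank. The hypothesis implies $\mathrm{rank}(A+\Delta A)=n$; $\ell_j>0$ implies $e_j^TA\ne0$. The symbol $\mathcal{O}(\epsilon_F^2)$ is understood for fixed $A$ as $\epsilon_F\to0$: it is a term bounded by $C\epsilon_F^2$ for all admissible $\Delta A$ with $\epsilon_F$ sufficiently small, where $C$ and the smallness threshold depend only on $A$. *)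

(* Defs.v *)
From HB Require Import structures.
From mathcomp Require Import all_boot all_order all_algebra.
From mathcomp Require Import boolp classical_sets reals.

Set Implicit Arguments.
Unset Strict Implicit.
Unset Printing Implicit Defensive.

Import Order.TTheory GRing.Theory Num.Theory.

Local Open Scope classical_set_scope.
Local Open Scope ring_scope.

Section Defs.
Variable R : realType.

Definition enorm n (v : 'rV[R]_n) : R := Num.sqrt (\sum_(j < n) v 0 j ^+ 2).

Definition frob_norm m n (A : 'M[R]_(m, n)) : R :=
  Num.sqrt (\sum_(i < m) \sum_(j < n) A i j ^+ 2).

(* The unit ball, rather than the unit sphere, keeps the set nonempty when
   n = 0. *)
Definition spec_norm m n (A : 'M[R]_(m, n)) : R :=
  sup [set enorm (A *m x)^T | x in [set x : 'cV[R]_n | enorm x^T <= 1]].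

Definition moore_penrose m n (A : 'M[R]_(m, n)) (X : 'M[R]_(n, m)) : Prop :=
  [/\ A *m X *m A = A, X *m A *m X = X,
      (A *m X)^T = A *m X & (X *m A)^T = X *m A].

(* This is the unique X with moore_penrose A X: see mpinvP and
   moore_penrose_uniq. The library's pinvmx is only a generalized inverse. *)
Definition mpinv m n (A : 'M[R]_(m, n)) : 'M[R]_(n, m) :=
  xget 0 [set X | moore_penrose A X].

Definition cond2 m n (A : 'M[R]_(m, n)) : R :=
  spec_norm A * spec_norm (mpinv A).

Definition stable_rank m n (A : 'M[R]_(m, n)) : R :=
  frob_norm A ^+ 2 / spec_norm A ^+ 2.

(* Row spaces of the transposes, i.e. column spaces (ranges), are compared. *)
Definition orthonormal_range_basis m n (A Q : 'M[R]_(m, n)) : Prop :=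
  Q^T *m Q = 1%:M /\ (Q^T == A^T)%MS.

(* The library's is_trig_mx means lower triangular. *)
Definition thin_qr m n (B Q : 'M[R]_(m, n)) (T : 'M[R]_n) : Prop :=
  [/\ B = Q *m T, Q^T *m Q = 1%:M, is_trig_mx T^T & T \in unitmx].

Definition leverage_scores m n (A : 'M[R]_(m, n)) (l : 'I_m -> R) : Prop :=
  exists2 Q : 'M[R]_(m, n), orthonormal_range_basis A Q &
    forall j, l j = enorm (row j Q) ^+ 2.

Definition qr_leverage_scores m n (B : 'M[R]_(m, n)) (l : 'I_m -> R) : Prop :=
  exists Q : 'M[R]_(m, n), exists2 T : 'M[R]_n, thin_qr B Q T &
    forall j, l j = enorm (row j Q) ^+ 2.

Definition relF m n (A dA : 'M[R]_(m, n)) : R := frob_norm dA / frob_norm A.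

Definition rel_row m n (A dA : 'M[R]_(m, n)) (j : 'I_m) : R :=
  enorm (row j dA) / enorm (row j A).

Lemma mulmx_tr_eq0 m n (A : 'M[R]_(m, n)) : A *m A^T = 0 -> A = 0.
Proof.
move=> A0; apply/matrixP => i j; rewrite mxE.
have : \sum_k A i k ^+ 2 = 0.
  have /matrixP/(_ i i) := A0; rewrite !mxE => Aii; rewrite -[RHS]Aii.
  by apply: eq_bigr => k _; rewrite mxE expr2.
move/eqP; rewrite psumr_eq0 => [|k _]; last exact: sqr_ge0.
by move/allP/(_ j (mem_index_enum _)); rewrite sqrf_eq0 => /eqP.
Qed.

Lemma gram_unit r n (G : 'M[R]_(r, n)) : row_free G -> G *m G^T \in unitmx.
Proof.
move=> fG; rewrite -row_free_unit -kermx_eq0; apply/eqP.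
set K := kermx _.
have K0 : K *m G *m (K *m G)^T = 0.
  by rewrite trmx_mul mulmxA -(mulmxA K) mulmx_ker mul0mx.
by apply: (row_free_inj fG); rewrite mul0mx; exact: mulmx_tr_eq0.
Qed.

Lemma moore_penrose_factor m r n (F : 'M[R]_(m, r)) (G : 'M[R]_(r, n)) :
  F^T *m F \in unitmx -> G *m G^T \in unitmx ->
  moore_penrose (F *m G)
    (G^T *m invmx (G *m G^T) *m invmx (F^T *m F) *m F^T).
Proof.
move=> uF uG; set g := invmx (G *m _); set f := invmx (F^T *m _).
have gT : g^T = g by rewrite trmx_inv trmx_mul trmxK.
have fT : f^T = f by rewrite trmx_inv trmx_mul trmxK.
have Gg : G *m (G^T *m g) = 1%:M by rewrite mulmxA mulmxV.
have fF : f *m (F^T *m F) = 1%:M by rewrite mulVmx.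
set X := _ *m F^T.
have AX : F *m G *m X = F *m f *m F^T.
  by rewrite /X !mulmxA -(mulmxA F G) -(mulmxA F) -(mulmxA G) Gg mulmx1.
have XA : X *m (F *m G) = G^T *m g *m G.
  by rewrite /X !mulmxA -(mulmxA _ F^T) -(mulmxA _ f) fF mulmx1.
split.
- by rewrite AX mulmxA -(mulmxA _ F^T) -(mulmxA F f) fF mulmx1.
- rewrite XA /X !mulmxA -(mulmxA _ G) -(mulmxA _ (G *m _)) -(mulmxA G).
  by rewrite Gg mulmx1.
- by rewrite AX !trmx_mul trmxK fT mulmxA.
- by rewrite XA !trmx_mul trmxK gT mulmxA.
Qed.

Lemma moore_penrose_exists m n (A : 'M[R]_(m, n)) :
  exists X, moore_penrose A X.
Proof.
have uG := gram_unit (row_base_free A).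
have uF : (col_base A)^T *m col_base A \in unitmx.
  rewrite -[X in _ *m X]trmxK; apply: gram_unit.
  by rewrite /row_free mxrank_tr; exact: col_base_full.
by have := moore_penrose_factor uF uG; rewrite mulmx_base; eexists; eassumption.
Qed.

Lemma moore_penrose_uniq m n (A : 'M[R]_(m, n)) X Y :
  moore_penrose A X -> moore_penrose A Y -> X = Y.
Proof.
move=> [X1 X2 X3 X4] [Y1 Y2 Y3 Y4].
have AXY : A *m X = A *m Y.
  by rewrite -X3 -{1}Y1 -mulmxA trmx_mul X3 Y3 mulmxA X1.
have XAY : X *m A = Y *m A.
  by rewrite -X4 -{1}Y1 -mulmxA mulmxA trmx_mul X4 Y4 -mulmxA (mulmxA A) X1.
by rewrite -X2 -mulmxA AXY mulmxA XAY Y2.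
Qed.

Lemma mpinvP m n (A : 'M[R]_(m, n)) : moore_penrose A (mpinv A).
Proof.
have [X AX] := moore_penrose_exists A.
exact: (@xgetPex _ 0 [set X | moore_penrose A X] (ex_intro _ X AX)).
Qed.

End Defs.

(* Main.v *)
(** Leverage scores are the diagonal entries of the orthogonal projector [P]
    onto the range of [A].  Let [P'] be the projector onto the range of
    [A + E] and [N] the Moore-Penrose inverse of [A].  Since [P'] fixes
    [A + E], one has [(1 - P') P = - (1 - P') E N].  As [P] and [P'] have the
    same trace, [(1 - P) P'] and [(1 - P') P] have the same Frobenius norm,
    hence both are bounded by the norm of [E N].  Splitting [P' - P] into
    blocks along [P] and [1 - P] then gives
    [P' - P = X + X^T + O(|E N|^2)] with [X = (1 - P) E N], and the [j]-th
    diagonal entry of [X] is estimated using that column [j] of [P] has squared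
    norm [P j j]. *)
Require Import Defs.
From HB Require Import structures.
From mathcomp Require Import all_boot all_order all_algebra.
From mathcomp Require Import boolp classical_sets reals.
From mathcomp Require Import ring lra.

Import Order.TTheory GRing.Theory Num.Theory.
Local Open Scope ring_scope.

(** * Frobenius and spectral norms *)

Section Norms.
Set Implicit Arguments.
Unset Strict Implicit.
Variable R : realType.

Lemma frob_norm_ge0 m n (A : 'M[R]_(m, n)) : 0 <= frob_norm A.
Proof. exact: sqrtr_ge0. Qed.

Lemma frob_norm_sqr m n (A : 'M[R]_(m, n)) :
  frob_norm A ^+ 2 = \sum_i \sum_j A i j ^+ 2.
Proof.
by rewrite sqr_sqrtr // !sumr_ge0 // => i _; rewrite sumr_ge0 // => j _;
  rewrite sqr_ge0.
Qed.

Lemma frob_norm_sqr_trace m n (A : 'M[R]_(m, n)) :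
  frob_norm A ^+ 2 = \tr (A *m A^T).
Proof.
rewrite frob_norm_sqr; apply: eq_bigr => i _; rewrite mxE.
by apply: eq_bigr => j _; rewrite mxE expr2.
Qed.

Lemma frob_norm_tr m n (A : 'M[R]_(m, n)) : frob_norm A^T = frob_norm A.
Proof.
rewrite /frob_norm exchange_big; congr Num.sqrt.
by apply: eq_bigr => i _; apply: eq_bigr => j _; rewrite mxE.
Qed.

Lemma enorm_frob n (v : 'rV[R]_n) : enorm v = frob_norm v.
Proof. by rewrite /frob_norm big_ord1. Qed.

Lemma frob_norm_row_sqr m n (A : 'M[R]_(m, n)) i :
  frob_norm (row i A) ^+ 2 = \sum_j A i j ^+ 2.
Proof.
by rewrite frob_norm_sqr big_ord1; apply: eq_bigr => j _; rewrite mxE.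
Qed.

Lemma frob_norm_col_sqr m n (A : 'M[R]_(m, n)) j :
  frob_norm (col j A) ^+ 2 = \sum_i A i j ^+ 2.
Proof.
by rewrite frob_norm_sqr; apply: eq_bigr => i _; rewrite big_ord1 mxE.
Qed.

Lemma ler_entry_frob_norm m n (A : 'M[R]_(m, n)) i j : `|A i j| <= frob_norm A.
Proof.
rewrite -(@ler_pXn2r _ 2) ?nnegrE ?frob_norm_ge0 // real_normK ?num_real //.
rewrite frob_norm_sqr (bigD1 i) //= (bigD1 j) //= -addrA lerDl.
rewrite addr_ge0 ?sumr_ge0 // => k _; rewrite ?sqr_ge0 //.
by rewrite sumr_ge0 // => ? _; rewrite sqr_ge0.
Qed.

Lemma frob_norm_eq0 m n (A : 'M[R]_(m, n)) : frob_norm A = 0 -> A = 0.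
Proof.
move=> A0; apply/matrixP => i j; rewrite mxE; apply/eqP.
by rewrite -normr_le0 -A0 ler_entry_frob_norm.
Qed.

(** The sum of the squares of [q * v i - c * w i] equals [q * (p * q - c ^+ 2)] and is nonnegative;
    dividing by [q] gives the claim. If [q = 0], every [w i] vanishes. *)
Lemma sum_cauchy_schwarz (I : finType) (v w : I -> R) :
  (\sum_i v i * w i) ^+ 2 <= (\sum_i v i ^+ 2) * (\sum_i w i ^+ 2).
Proof.
set c := \sum_i v i * w i; set p := \sum_i v i ^+ 2; set q := \sum_i w i ^+ 2.
have q_ge0 : 0 <= q by rewrite sumr_ge0 // => i _; rewrite sqr_ge0.
have [q0|q_neq0] := eqVneq q 0.
  suff -> : c = 0 by rewrite q0 mulr0 expr0n.
  move/eqP: q0; rewrite psumr_eq0 => [/allP w0|? _]; last exact: sqr_ge0.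
  apply: big1 => i _; have := w0 i (mem_index_enum _).
  by rewrite /= sqrf_eq0 => /eqP ->; rewrite mulr0.
have : 0 <= \sum_i (q * v i - c * w i) ^+ 2.
  by rewrite sumr_ge0 // => i _; rewrite sqr_ge0.
have -> : \sum_i (q * v i - c * w i) ^+ 2 = q * (p * q - c ^+ 2).
  transitivity (\sum_i (q ^+ 2 * v i ^+ 2 - 2 * q * c * (v i * w i)
                        + c ^+ 2 * w i ^+ 2)).
    by apply: eq_bigr => i _; ring.
  by rewrite big_split sumrB /= -!mulr_sumr -/c -/p -/q; ring.
by rewrite pmulr_rge0 ?subr_ge0 // lt_def q_neq0.
Qed.

Lemma mulmx_entry_le m n p (A : 'M[R]_(m, n)) (B : 'M[R]_(n, p)) i j :
  `|(A *m B) i j| <= frob_norm (row i A) * frob_norm (col j B).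
Proof.
rewrite -(@ler_pXn2r _ 2) ?nnegrE ?mulr_ge0 ?frob_norm_ge0 //.
rewrite real_normK ?num_real // exprMn frob_norm_row_sqr frob_norm_col_sqr mxE.
exact: sum_cauchy_schwarz.
Qed.

Lemma frob_normM m n p (A : 'M[R]_(m, n)) (B : 'M[R]_(n, p)) :
  frob_norm (A *m B) <= frob_norm A * frob_norm B.
Proof.
rewrite -(@ler_pXn2r _ 2) ?nnegrE ?mulr_ge0 ?frob_norm_ge0 //.
rewrite exprMn -(frob_norm_tr B) !frob_norm_sqr mulr_suml ler_sum // => i _.
rewrite mulr_sumr ler_sum // => j _.
rewrite mxE; apply: le_trans (sum_cauchy_schwarz _ _) _.
by under [X in _ <= _ * X]eq_bigr do rewrite mxE.
Qed.

Lemma frob_normZ m n a (A : 'M[R]_(m, n)) :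
  frob_norm (a *: A) = `|a| * frob_norm A.
Proof.
rewrite /frob_norm -sqrtr_sqr -sqrtrM ?sqr_ge0 // mulr_sumr.
congr Num.sqrt; apply: eq_bigr => i _; rewrite mulr_sumr.
by apply: eq_bigr => j _; rewrite mxE exprMn.
Qed.

(** The [sup] in [spec_norm] is a genuine least upper bound only for a bounded set; the Frobenius
    norm provides the bound. *)
Lemma spec_norm_has_ubound m n (A : 'M[R]_(m, n)) :
  has_ubound
    [set enorm (A *m x)^T | x in [set x : 'cV[R]_n | enorm x^T <= 1]]%classic.
Proof.
exists (frob_norm A) => _ [y /= y1 <-].
rewrite enorm_frob frob_norm_tr; apply: le_trans (frob_normM _ _) _.
by rewrite ler_piMr ?frob_norm_ge0 // -frob_norm_tr -enorm_frob.
Qed.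

Lemma frob_norm0 m n : frob_norm (0 : 'M[R]_(m, n)) = 0.
Proof. by rewrite -(scale0r 0) frob_normZ normr0 mul0r. Qed.

Lemma spec_norm_ge0 m n (A : 'M[R]_(m, n)) : 0 <= spec_norm A.
Proof.
apply: ub_le_sup; first exact: spec_norm_has_ubound.
by exists 0; rewrite /= enorm_frob ?mulmx0 linear0 frob_norm0.
Qed.

Lemma mulmx_col_le m n (A : 'M[R]_(m, n)) (x : 'cV[R]_n) :
  frob_norm (A *m x) <= spec_norm A * frob_norm x.
Proof.
have [x0|x_neq0] := eqVneq (frob_norm x) 0.
  by apply: le_trans (frob_normM _ _) _; rewrite x0 !mulr0.
have x_gt0 : 0 < frob_norm x by rewrite lt_def x_neq0 frob_norm_ge0.
rewrite -ler_pdivrMr // mulrC -[X in X * _]gtr0_norm ?invr_gt0 //.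
rewrite -frob_normZ scalemxAr -(frob_norm_tr (_ *m _)) -enorm_frob.
apply: ub_le_sup; first exact: spec_norm_has_ubound.
exists ((frob_norm x)^-1 *: x) => //=.
by rewrite enorm_frob frob_norm_tr frob_normZ gtr0_norm ?invr_gt0 // mulVf.
Qed.

(** The spectral norm also controls the action on rows: the squared norm of [w *m A] is the product
    of [w] with [A *m (w *m A)^T], so one factor [frob_norm (w *m A)] cancels. *)
Lemma mulmx_row_le m n (A : 'M[R]_(m, n)) (w : 'rV[R]_m) :
  frob_norm (w *m A) <= spec_norm A * frob_norm w.
Proof.
have [->|wA_neq0] := eqVneq (frob_norm (w *m A)) 0.
  by rewrite mulr_ge0 ?spec_norm_ge0 ?frob_norm_ge0.
have wA_gt0 : 0 < frob_norm (w *m A) by rewrite lt_def wA_neq0 frob_norm_ge0.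
rewrite -(ler_pM2r wA_gt0) -expr2 frob_norm_sqr_trace /mxtrace big_ord1.
rewrite -mulmxA; apply: le_trans (ler_norm _) _.
apply: le_trans (ler_entry_frob_norm _ _ _) _.
apply: le_trans (frob_normM _ _) _.
rewrite [X in _ <= X * _]mulrC -mulrA ler_wpM2l ?frob_norm_ge0 //.
by rewrite -[X in _ <= _ * X]frob_norm_tr mulmx_col_le.
Qed.

End Norms.

(** * Orthogonal projectors and their perturbation *)

Section Projectors.
Set Implicit Arguments.
Unset Strict Implicit.
Variable R : realType.

Definition orthoproj m (P : 'M[R]_m) := P^T = P /\ P *m P = P.

Lemma orthoprojC m (P : 'M[R]_m) : orthoproj P -> orthoproj (1%:M - P).
Proof.
move=> [PT PP]; split; first by rewrite linearB /= trmx1 PT.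
by rewrite mulmxBl mul1mx mulmxBr mulmx1 PP subrr subr0.
Qed.

Lemma orthoproj_orthonormal m n (Q : 'M[R]_(m, n)) :
  Q^T *m Q = 1%:M -> orthoproj (Q *m Q^T).
Proof.
move=> QQ; split; first by rewrite trmx_mul trmxK.
by rewrite -mulmxA (mulmxA Q^T) QQ mul1mx.
Qed.

Lemma trace_orthonormal m n (Q : 'M[R]_(m, n)) :
  Q^T *m Q = 1%:M -> \tr (Q *m Q^T) = n%:R.
Proof. by move=> QQ; rewrite mxtrace_mulC QQ mxtrace1. Qed.

Lemma orthonormal_diag m n (Q : 'M[R]_(m, n)) j :
  (Q *m Q^T) j j = enorm (row j Q) ^+ 2.
Proof.
rewrite enorm_frob frob_norm_row_sqr mxE.
by apply: eq_bigr => k _; rewrite mxE expr2.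
Qed.

(** Compare the [j]-th diagonal entries in [P *m P^T = P]. This turns a leverage score into a
    squared row norm, which later cancels the denominator of the relative error. *)
Lemma orthoproj_row_norm m (P : 'M[R]_m) j :
  orthoproj P -> frob_norm (row j P) ^+ 2 = P j j.
Proof.
move=> [PT PP]; rewrite frob_norm_row_sqr -{2}PP mxE.
by apply: eq_bigr => k _; rewrite -{3}PT mxE expr2.
Qed.

(** Both sides are symmetric and fix the same range: [Q *m Q^T] fixes [A], and [A *m mpinv A] fixes
    [Q]. Transposing the first relation identifies the two. *)
Lemma orthoproj_mpinv m n (A Q : 'M[R]_(m, n)) :
  orthonormal_range_basis A Q -> Q *m Q^T = A *m mpinv A.
Proof.
move=> [QQ /andP[/submxP[M QM] /submxP[K AK]]].
have [A1 _ A3 _] := mpinvP A.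
have QA : A *m mpinv A *m Q = Q.
  by rewrite -[Q]trmxK QM trmx_mul trmxK !mulmxA A1.
have AQ : Q *m Q^T *m A = A.
  rewrite -[A]trmxK AK trmx_mul trmxK.
  by rewrite -mulmxA (mulmxA Q^T) QQ mul1mx.
have /(congr1 trmx) : Q *m Q^T *m (A *m mpinv A) = A *m mpinv A.
  by rewrite mulmxA AQ.
by rewrite trmx_mul A3 (orthoproj_orthonormal QQ).1 mulmxA QA.
Qed.

(** Pythagoras: the squared norms of [M] and [P *m M] differ by that of [(1%:M - P) *m M], as the
    trace formula [sqr] shows. *)
Lemma frob_norm_proj_le m p (P : 'M[R]_m) (M : 'M[R]_(m, p)) :
  orthoproj P -> frob_norm (P *m M) <= frob_norm M.
Proof.
have sqr (S : 'M[R]_m) : orthoproj S ->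
    frob_norm (S *m M) ^+ 2 = \tr (S *m (M *m M^T)).
  move=> [ST SS]; rewrite frob_norm_sqr_trace trmx_mul ST.
  rewrite mxtrace_mulC -mulmxA (mulmxA S S) SS.
  by rewrite (mulmxA S) [RHS]mxtrace_mulC.
move=> pP; rewrite -(@ler_pXn2r _ 2) ?nnegrE ?frob_norm_ge0 //.
rewrite -subr_ge0 [X in X - _]frob_norm_sqr_trace (sqr _ pP) -linearB /=.
by rewrite -{1}(mul1mx (M *m _)) -mulmxBl -sqr ?sqr_ge0 //; exact: orthoprojC.
Qed.

(** The two squared norms are [\tr P' - \tr (P *m P')] and [\tr P - \tr (P' *m P)], which agree by
    cyclicity of the trace. *)
Lemma frob_norm_projC_proj m (P P' : 'M[R]_m) :
  orthoproj P -> orthoproj P' -> \tr P = \tr P' ->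
  frob_norm ((1%:M - P) *m P') = frob_norm ((1%:M - P') *m P).
Proof.
have sqr (S T : 'M[R]_m) : orthoproj S -> orthoproj T ->
    frob_norm ((1%:M - S) *m T) ^+ 2 = \tr T - \tr (S *m T).
  move=> pS [TT TTT]; have [CT CC] := orthoprojC pS.
  rewrite frob_norm_sqr_trace trmx_mul CT TT mxtrace_mulC mulmxA.
  rewrite -(mulmxA T) CC mxtrace_mulC mulmxA TTT mxtrace_mulC.
  by rewrite mulmxBl mul1mx linearB.
move=> pP pP' trP; apply/eqP.
rewrite -(@eqrXn2 _ 2) ?frob_norm_ge0 //; apply/eqP.
by rewrite !sqr // trP mxtrace_mulC.
Qed.

(** The terms are the four blocks of [P' - P] along [1%:M - P] and [P]: [G *m G^T] and
    [- (H^T *m H)] are the diagonal blocks, [- W] and [- W^T] the off-diagonal ones. *)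
Lemma orthoproj_sub_blocks m (P P' : 'M[R]_m) : orthoproj P -> orthoproj P' ->
  let G := (1%:M - P) *m P' in let H := (1%:M - P') *m P in
  let W := (1%:M - P) *m H in
  P' - P = G *m G^T - H^T *m H - W - W^T.
Proof.
move=> [PT PP] [P'T PP'].
have [_ CC] := orthoprojC (conj P'T PP').
move=> G H W.
have -> : G *m G^T = P' - P *m P' - P' *m P + P *m P' *m P.
  rewrite /G trmx_mul P'T linearB /= trmx1 PT mulmxA -(mulmxA _ P' P') PP'.
  by rewrite mulmxBr mulmx1 !mulmxBl !mul1mx opprB addrA addrAC.
have -> : H^T *m H = P - P *m P' *m P.
  rewrite /H trmx_mul PT linearB /= trmx1 P'T mulmxA -(mulmxA P _ (1%:M - P')) CC.
  by rewrite mulmxBr mulmx1 mulmxBl PP.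
have WE : W = - (P' *m P - P *m P' *m P).
  rewrite /W /H mulmxA mulmxBl mul1mx mulmxBr mulmx1 !mulmxBl mul1mx PP.
  by rewrite !opprB addrC addrA subrK.
have WT : W^T = - (P *m P' - P *m P' *m P).
  by rewrite WE linearN linearB /= !trmx_mul PT P'T mulmxA.
rewrite WT WE; apply/matrixP => i j.
move: (P *m P' *m P) (P *m P') (P' *m P) => U V V'.
rewrite !mxE; ring.
Qed.

Lemma orthoproj_diag_perturbation m n (A E : 'M[R]_(m, n)) (N : 'M[R]_(n, m))
    (P' : 'M[R]_m) j :
  let P := A *m N in
  orthoproj P -> orthoproj P' -> \tr P = \tr P' ->
  P' *m (A + E) = A + E ->
  `|P' j j - P j j| <= 2 * `|((1%:M - P) *m (E *m N)) j j|
                       + 4 * frob_norm (E *m N) ^+ 2.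
Proof.
move=> P pP pP' trP fixE.
have := orthoproj_sub_blocks pP pP'.
set G := _ *m P'; set H := (1%:M - P') *m P; cbv zeta => DE.
set M := E *m N.
have HE : H = - ((1%:M - P') *m M).
  rewrite /H /P /M !mulmxA -mulNmx; congr (_ *m N); apply/eqP.
  by rewrite -addr_eq0 -mulmxDr mulmxBl mul1mx fixE subrr.
set t := frob_norm M.
have Ht : frob_norm H <= t.
  rewrite HE -scaleN1r frob_normZ normrN1 mul1r.
  by apply: frob_norm_proj_le; exact: orthoprojC.
have Gt : frob_norm G <= t by rewrite frob_norm_projC_proj.
have sqr_le p q (B : 'M[R]_(p, q)) (B' : 'M[R]_(q, p)) i :
    frob_norm B <= t -> frob_norm B' <= t -> `|(B *m B') i i| <= t ^+ 2.
  move=> Bt B't; apply: le_trans (ler_entry_frob_norm _ _ _) _.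
  apply: le_trans (frob_normM _ _) _.
  by rewrite expr2 ler_pM ?frob_norm_ge0.
have GG : `|(G *m G^T) j j| <= t ^+ 2 by rewrite sqr_le // frob_norm_tr.
have HH : `|(H^T *m H) j j| <= t ^+ 2 by rewrite sqr_le // frob_norm_tr.
have GM : `|(G *m M) j j| <= t ^+ 2 by rewrite sqr_le.
(* Writing [1%:M - P'] as a difference separates the first-order part of the off-diagonal block from
   [G *m M], which is quadratic in [M]. *)
have WE : ((1%:M - P) *m H) j j = (G *m M) j j - ((1%:M - P) *m M) j j.
  rewrite HE mulmxN [(1%:M - P') *m M]mulmxBl mul1mx mulmxBr mulmxA -/G opprB.
  by move: (G *m M) ((1%:M - P) *m M) => U V; rewrite !mxE.
have -> : P' j j - P j j = (P' - P) j j by rewrite !mxE.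
(* A block and its transpose share their diagonal, so the first-order entry and that of [G *m M]
   both count twice. With [G *m G^T] and [H^T *m H] this makes the constants 2 and 4. *)
rewrite DE; move: GG HH GM WE.
move: (G *m G^T) (H^T *m H) (G *m M) ((1%:M - P) *m M) ((1%:M - P) *m H).
move=> U V X Y W; rewrite !mxE => GG HH GM ->.
rewrite !ler_norml in GG HH GM *.
have : - `|Y j j| <= Y j j <= `|Y j j| by rewrite -ler_norml.
lra.
Qed.

End Projectors.

Theorem theorem3p2 (R : realType) (m n : nat) (A : 'M[R]_(m, n))
    (rankA : \rank A = n) :
  exists C delta : R, 0 < delta /\
    forall (dA : 'M[R]_(m, n)) (l l' : 'I_m -> R),
      spec_norm dA * spec_norm (mpinv A) < 1 ->
      leverage_scores A l ->
      qr_leverage_scores (A + dA) l' ->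
      relF A dA < delta ->
      forall j : 'I_m, 0 < l j ->
        `|l' j - l j| / l j <=
          2 * (rel_row A dA j
               + Num.sqrt 2 * Num.sqrt (stable_rank A) * relF A dA) * cond2 A
          + C * relF A dA ^+ 2.
Proof.
set N := mpinv A; set P := A *m N.
(* A bound on the inverses of all positive leverage scores that depends on [A] alone; a zero score
   contributes 0, since the inverse of 0 is 0. *)
pose c := \sum_i `|(P i i)^-1|.
exists (4 * (frob_norm A * frob_norm N) ^+ 2 * c), 1; split=> // E l l' _.
move=> [Q bQ lQ] [Q' [T [BQ QQ' _ _] lQ']] _ j.
have QP : Q *m Q^T = P by exact: orthoproj_mpinv.
have QQ : Q^T *m Q = 1%:M by case: bQ.
have pP : orthoproj P by rewrite -QP; exact: orthoproj_orthonormal.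
have pP' := orthoproj_orthonormal QQ'.
have fixE : Q' *m Q'^T *m (A + E) = A + E.
  by rewrite BQ -mulmxA (mulmxA Q'^T) QQ' mul1mx.
have trP : \tr P = \tr (Q' *m Q'^T) by rewrite -QP !trace_orthonormal.
have lP : l j = P j j by rewrite -QP orthonormal_diag lQ.
have -> : l' j = (Q' *m Q'^T) j j by rewrite orthonormal_diag lQ'.
have := orthoproj_diag_perturbation j pP pP' trP fixE.
rewrite lP => + l_gt0.
set d := `|_ - P j j|; set x := `|_|; set t := frob_norm (E *m N) => d_le.
have rowP2 := orthoproj_row_norm j pP.
set s := frob_norm (row j P) in rowP2.
have s_gt0 : 0 < s.
  rewrite lt_def frob_norm_ge0 andbT; apply: contraTneq l_gt0 => s0.
  by rewrite -rowP2 s0 expr0n ltxx.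
(* Through these two identities, row [j] of [A] and column [j] of [N] factor through row and column
   [j] of [P]. Each thus gains a factor [s], with [s ^+ 2] the leverage score. *)
have PA : P *m A = A by case: (mpinvP A).
have NP : N *m P = N by rewrite /P mulmxA; case: (mpinvP A).
have rowA : frob_norm (row j A) <= spec_norm A * s.
  by rewrite -{1}PA row_mul mulmx_row_le.
have colN : frob_norm (col j N) <= spec_norm N * s.
  rewrite -{1}NP colE -mulmxA -colE; apply: le_trans (mulmx_col_le _ _) _.
  by rewrite -frob_norm_tr tr_col pP.1.
(* Row [j] of [P] is row [j] of [A] times [N], so it would vanish with it. Hence the denominator in
   [rel_row] is nonzero. *)
have rowA_gt0 : 0 < frob_norm (row j A).
  rewrite lt_def frob_norm_ge0 andbT; apply: contraTneq s_gt0 => A0.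
  by rewrite /s row_mul (frob_norm_eq0 A0) mul0mx frob_norm0 ltxx.
have S_gt0 : 0 < spec_norm A.
  by have := lt_le_trans rowA_gt0 rowA; rewrite pmulr_lgt0.
have F_gt0 : 0 < frob_norm A.
  rewrite lt_def frob_norm_ge0 andbT; apply: contraTneq rowA_gt0 => A0.
  by rewrite (frob_norm_eq0 A0) linear0 frob_norm0 ltxx.
set a := frob_norm (row j A) in rowA rowA_gt0.
set F := frob_norm A in F_gt0 *; set S := spec_norm A in rowA S_gt0 *.
pose r := frob_norm (row j E); pose f := frob_norm E; pose SN := spec_norm N.
have [r_ge0 f_ge0 SN_ge0] : [/\ 0 <= r, 0 <= f & 0 <= SN].
  by rewrite !frob_norm_ge0 spec_norm_ge0.
(* Split the entry into those of [E *m N] and [P *m E *m N]: the former sees only row [j] of [E],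
   the latter all of [E] weighted by row [j] of [P]. *)
have x_le : x <= (r + s * f) * (SN * s).
  have -> : x = `|(E *m N) j j - (P *m E *m N) j j|.
    rewrite /x mulmxBl mul1mx mulmxA.
    by move: (E *m N) (P *m E *m N) => U V; rewrite !mxE.
  apply: le_trans (ler_normB _ _) _; rewrite mulrDl lerD //.
    apply: le_trans (mulmx_entry_le _ _ _ _) _.
    by rewrite ler_wpM2l.
  apply: le_trans (mulmx_entry_le _ _ _ _) _.
  by rewrite ler_pM ?frob_norm_ge0 // row_mul frob_normM.
pose rho := rel_row A E j; pose phi := relF A E.
have rE : r = rho * a.
  by rewrite /rho /rel_row !enorm_frob -/a -/r divfK // gt_eqF.
have fE : f = phi * F by rewrite /phi /relF -/F -/f divfK // gt_eqF.
have srE : Num.sqrt (stable_rank A) = F / S.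
  rewrite /stable_rank -/F -/S -expr_div_n sqrtr_sqr ger0_norm //.
  by rewrite divr_ge0 // ltW.
have rho_ge0 : 0 <= rho by rewrite divr_ge0 ?enorm_frob ?frob_norm_ge0.
have main_le : x / P j j <= (rho + Num.sqrt 2 * (F / S) * phi) * (S * SN).
  rewrite ler_pdivrMr // -rowP2; apply: le_trans x_le _.
  have -> : (rho + Num.sqrt 2 * (F / S) * phi) * (S * SN) * s ^+ 2
      = (rho * (S * s) + Num.sqrt 2 * (s * f)) * (SN * s).
    by rewrite fE; field; rewrite gt_eqF.
  (* The row term uses [a <= S * s]; the other term is enlarged by [Num.sqrt 2], which is at least
     1. *)
  rewrite ler_wpM2r ?mulr_ge0 ?frob_norm_ge0 // rE lerD ?ler_wpM2l //.
  rewrite ler_peMl ?mulr_ge0 ?frob_norm_ge0 //.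
  by rewrite -[leLHS]sqrtr1 ler_wsqrtr // ler1n.
have c_ge : (P j j)^-1 <= c.
  apply: le_trans (ler_norm _) _.
  by rewrite /c (bigD1 j) //= lerDl sumr_ge0.
have rem_le : t ^+ 2 / P j j <= (F * frob_norm N) ^+ 2 * c * phi ^+ 2.
  have -> : (F * frob_norm N) ^+ 2 * c * phi ^+ 2 = (f * frob_norm N) ^+ 2 * c.
    by rewrite fE; ring.
  rewrite ler_pM ?sqr_ge0 ?invr_ge0 ?(ltW l_gt0) //.
  by rewrite ler_pXn2r ?nnegrE ?mulr_ge0 ?frob_norm_ge0 // frob_normM.
(* It remains to add twice [main_le] and four times [rem_le]. *)
apply: (@le_trans _ _ ((2 * x + 4 * t ^+ 2) / P j j)).
  by rewrite ler_pM2r ?invr_gt0.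
rewrite srE /cond2 -/S -/N -/SN -/rho -/phi.
lra.
Qed.
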